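(* For all positive integers $m,n$ with $mn$ even, the graph $\mathcal{D}_3(\mathbb{T}_{m,n})$ is connected and has diameter at most $2mn$.
   Context: The triangular lattice $\mathbb{T}$ is the graph with vertex set $\mathbb{Z}^2$ in which each vertex $\mathbf{v}$ is adjacent to $\mathbf{v}+(1,0),\mathbf{v}+(-1,0),\mathbf{v}+(0,1),\mathbf{v}+(0,-1),\mathbf{v}+(1,-1),\mathbf{v}+(-1,1)$. $\mathbb{T}_{m,n}$ is the subgraph of $\mathbb{T}$ induced by $\{1,\dots,m\}\times\{1,\dots,n\}$. A dimer configuration on a graph $G$ is a perfect matching; its edges are dimers. An alternating cycle is a cycle of even length in which every second edge is a dimer; switching it exchanges dimer and non-dimer edges along the cycle. For $\ell\ge 2$, $\mathcal{D}_\ell(G)$ is the graph on dimer configurations of $G$ in which two configurations are adjacent if one is obtained from the other by switching an alternating cycle of length at most $2\ell$ (so $\mathcal{D}_3$ uses cycles of length $4$ and $6$). *)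

(* Defs.v *)
From HB Require Import structures.
From mathcomp Require Import all_boot all_order all_algebra.

Set Implicit Arguments.
Unset Strict Implicit.
Unset Printing Implicit Defensive.

Import GRing.Theory.

(* A finite simple graph is a finType of vertices together with its adjacency
   relation. *)

Section GraphDistance.
Variables (T : finType) (e : rel T).

Definition connected_graph : bool :=
  (0 < #|T|) && [forall x, forall y, connect e x y].

(* Least length of an [e]-path from [x] to [y]; a shortest path has fewer than
   [#|T|] edges, and the value is [#|T|] when there is no path at all. *)
Definition dist (x y : T) : nat :=
  find (fun k => [exists p : k.-tuple T, path e x p && (last x p == y)])
       (iota 0 #|T|).

Definition diameter : nat := \max_(x : T) \max_(y : T) dist x y.

End GraphDistance.

Section Dimers.
Variables (V : finType) (e : rel V).

Definition edge_set : {set {set V}} :=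
  [set [set p.1; p.2] | p : V * V & e p.1 p.2].

Definition perfect_matching (M : {set {set V}}) : bool :=
  (M \subset edge_set) && partition M [set: V].

Definition dimer_config : finType := {M : {set {set V}} | perfect_matching M}.

Definition cycle_edges (c : seq V) : {set {set V}} :=
  [set [set x; next c x] | x in c].

(* The last clause says that of any two consecutive edges of the cycle exactly
   one is a dimer. The length is at least 3, as for any cycle of a simple graph,
   hence at least 4; [ucycleb] alone would accept a single edge as a 2-cycle. *)
Definition alternating_cycle (M : {set {set V}}) (c : seq V) : bool :=
  [&& 2 < size c, ~~ odd (size c), ucycleb e c &
      all (fun x => ([set next c x; next c (next c x)] \in M)
                    != ([set x; next c x] \in M)) c].

Definition switch (M : {set {set V}}) (c : seq V) : {set {set V}} :=
  (M :\: cycle_edges c) :|: (cycle_edges c :\: M).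

Definition dimer_adj (l : nat) : rel dimer_config := fun M N =>
  [exists k : 'I_(2 * l).+1, exists c : k.-tuple V,
     alternating_cycle (val M) c && (val N == switch (val M) c)].

Lemma in_switch M c A : (A \in switch M c) = (A \in M) (+) (A \in cycle_edges c).
Proof. by rewrite !inE; case: (A \in M); case: (A \in _). Qed.

Lemma switchK M c : switch (switch M c) c = M.
Proof. by apply/setP=> A; rewrite !in_switch -addbA addbb addbF. Qed.

Lemma alternating_cycle_switch M c :
  alternating_cycle (switch M c) c = alternating_cycle M c.
Proof.
congr [&& _, _, _ & _]; apply: eq_in_all => x cx.
rewrite !in_switch (imset_f (fun x => [set x; next c x]) cx).
rewrite (imset_f (fun x => [set x; next c x])) ?mem_next //.
by do 2 case: (_ \in M).
Qed.

Lemma dimer_adj_sym l : symmetric (dimer_adj l).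
Proof.
suff H M N : dimer_adj l M N -> dimer_adj l N M by move=> M N; apply/idP/idP; apply: H.
case/existsP=> k /existsP[c /andP[Mc /eqP defN]].
apply/existsP; exists k; apply/existsP; exists c.
by rewrite defN alternating_cycle_switch Mc switchK eqxx.
Qed.

Lemma dimer_adj_irr l : irreflexive (dimer_adj l).
Proof.
move=> M; apply/existsP=> -[k /existsP[c /andP[/andP[c_gt2 _] /eqP/setP defM]]].
case: (tval c) c_gt2 defM => // x s _ /(_ [set x; next (x :: s) x]).
rewrite in_switch (imset_f (fun y => [set y; next (x :: s) y])) ?mem_head //.
by case: (_ \in val M).
Qed.

End Dimers.

Section TriangularLattice.
Local Open Scope ring_scope.

Definition tri_lattice : rel (int * int) := fun u v =>
  v - u \in [:: (1, 0); (-1, 0); (0, 1); (0, -1); (1, -1); (-1, 1)].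

(* Ordinals start at 0, so the vertex [(i, j)] stands for the lattice point
   [(i + 1, j + 1)] of [{1..m} x {1..n}]. *)
Definition lattice_point (m n : nat) (u : 'I_m * 'I_n) : int * int :=
  ((u.1).+1%:Z, (u.2).+1%:Z).

Definition tri_rect (m n : nat) : rel ('I_m * 'I_n) :=
  relpre (@lattice_point m n) tri_lattice.

Lemma tri_rect_sym m n : symmetric (@tri_rect m n).
Proof.
move=> u v; rewrite /tri_rect /= /tri_lattice -opprB.
case: (_ - _) => a b; rewrite !inE !xpair_eqE !eqr_oppLR !opprK oppr0.
by do !case: (_ == _).
Qed.

Lemma tri_rect_irr m n : irreflexive (@tri_rect m n).
Proof. by move=> u; rewrite /tri_rect /= /tri_lattice subrr. Qed.

End TriangularLattice.

(* Main.v *)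
(* After transposing, the width is even and the target configuration consists of
   the horizontal dimers joining columns 2i-1 and 2i. Its dimers are created in
   row-major order without touching the earlier ones. A finite case analysis near
   the first unprocessed site shows that one more target dimer can be obtained in
   at most 2 moves, or else the next two in at most 4. So every configuration is
   within mn moves of the target, which gives diameter at most 2mn. *)
Require Import Defs.
From mathcomp Require Import all_boot all_order all_algebra.
From mathcomp Require Import zify.

Set Implicit Arguments.
Unset Strict Implicit.
Unset Printing Implicit Defensive.

(** * Paths of bounded length, distance and diameter *)

Section Reachability.
Variables (T : finType) (e : rel T).

Definition within (r : nat) (Q : T -> Prop) (x : T) : Prop :=
  exists p, [/\ path e x p, size p <= r & Q (last x p)].

Lemma within0 r (Q : T -> Prop) x : Q x -> within r Q x.
Proof. by move=> Qx; exists [::]. Qed.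

Lemma withinS r (Q : T -> Prop) x y : e x y -> within r Q y -> within r.+1 Q x.
Proof. by move=> exy [p [yp szp Qp]]; exists (y :: p); rewrite /= exy. Qed.

Lemma within_le r s (Q : T -> Prop) x : r <= s -> within r Q x -> within s Q x.
Proof. by move=> le_rs [p [xp szp Qp]]; exists p; rewrite (leq_trans szp). Qed.

Lemma within_trans r s (Q S : T -> Prop) x :
  within r Q x -> (forall y, Q y -> within s S y) -> within (r + s) S x.
Proof.
case=> p [xp szp Qp] /(_ _ Qp)[q [yq szq Sq]]; exists (p ++ q).
by rewrite cat_path xp yq size_cat leq_add ?last_cat.
Qed.

Lemma within_sym r x y : symmetric e -> within r (eq y) x -> within r (eq x) y.
Proof.
move=> sym_e [p [xp szp ->]]; exists (rev (belast x p)).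
rewrite rev_path -(eq_path (e := e)) => [|u v]; last exact: sym_e.
rewrite xp size_rev size_belast; split=> //.
by case: p {xp szp} => //= z p; rewrite rev_cons last_rcons.
Qed.

(** [dist] searches only lengths below [#|T|], so the path is first shortened to one without
    repeated vertices. *)
Lemma dist_le r x y : within r (eq y) x -> dist e x y <= r.
Proof.
case=> p [xp szp def_y]; rewrite def_y; case/shortenP: xp => q xq Uq sub_qp.
have szq: size q <= r.
  by rewrite (leq_trans _ szp) // uniq_leq_size // -[uniq q]andTb; case/andP: Uq.
have ltqT: size q < #|T| by rewrite -[(size q).+1]/(size (x :: q)) -(card_uniqP Uq) max_card.
apply: leq_trans szq; rewrite /dist; set a := fun k => _.
have a_q: a (size q) by apply/existsP; exists (in_tuple q); rewrite xq eqxx.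
rewrite leqNgt; apply/negP=> /(before_find 0); rewrite nth_iota //.
by rewrite add0n a_q.
Qed.

(** Any two vertices are joined through the hub [c], by following one path and then reversing the
    other. *)
Lemma connected_diameter_le r (c : T) : symmetric e ->
  (forall x, within r (eq c) x) ->
  connected_graph e /\ diameter e <= r + r.
Proof.
move=> sym_e to_c.
have xy_within x y : within (r + r) (eq y) x.
  by apply: within_trans (to_c x) _ => _ <-; apply: within_sym.
split; last by apply/bigmax_leqP=> x _; apply/bigmax_leqP=> y _; apply: dist_le.
apply/andP; split; first by apply/card_gt0P; exists c.
apply/forallP=> x; apply/forallP=> y; have [p [xp _ def_y]] := xy_within x y.
by apply/connectP; exists p.
Qed.

End Reachability.

(** * Perfect matchings and the effect of switching an alternating cycle *)

Section Switching.
Variables (V : finType) (e : rel V).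
Hypothesis e_irr : irreflexive e.
Implicit Types (M A B : {set {set V}}) (c : seq V).

Lemma matching_cover M x : perfect_matching e M -> exists2 E, E \in M & x \in E.
Proof.
case/andP=> _ /and3P[/eqP covM _ _].
by have: x \in cover M; [rewrite covM inE | case/bigcupP=> E; exists E].
Qed.

Lemma matching_inj M x E F : perfect_matching e M ->
  E \in M -> F \in M -> x \in E -> x \in F -> E = F.
Proof.
case/andP=> _ /and3P[_ tiM _] ME MF Ex Fx.
by rewrite -(def_pblock tiM ME Ex) (def_pblock tiM MF Fx).
Qed.

Lemma perfect_matchingI M : M \subset edge_set e ->
    (forall x, exists2 E, E \in M & x \in E) ->
    (forall x E F, E \in M -> F \in M -> x \in E -> x \in F -> E = F) ->
  perfect_matching e M.
Proof.
move=> sMe covM injM; rewrite /perfect_matching sMe /=; apply/and3P; split.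
- rewrite eqEsubset subsetT /=; apply/subsetP=> x _; have [E ME Ex] := covM x.
  by apply/bigcupP; exists E.
- apply/trivIsetP=> E F ME MF; apply: contraNT; rewrite -setI_eq0.
  by case/set0Pn=> x /setIP[Ex Fx]; apply/eqP; apply: (injM x).
apply/negP=> /(subsetP sMe)/imsetP[[x y] _ /= /setP/(_ x)].
by rewrite !inE eqxx.
Qed.

(** An edge is an unordered pair and [e] is only assumed irreflexive, hence the disjunction. *)
Lemma matching_edge M x y : perfect_matching e M ->
  [set x; y] \in M -> e x y || e y x.
Proof.
case/andP=> /subsetP sMe _ /sMe/imsetP[[u v]]; rewrite inE /= => euv.
move/setP=> def_xy; move: (def_xy x) (def_xy y) (def_xy u) (def_xy v).
rewrite !inE !eqxx ?orbT /= ?[_ || true]orbT.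
move=> /esym/orP[/eqP->|/eqP->] /esym/orP[/eqP->|/eqP->]; rewrite ?euv ?orbT //.
  by rewrite !orbb eqxx => _ /eqP eq_vu; rewrite eq_vu e_irr in euv.
by rewrite !orbb eqxx => /eqP eq_uv; rewrite eq_uv e_irr in euv.
Qed.

Lemma matching_mate_ex M x : perfect_matching e M ->
  exists2 y, e x y || e y x & [set x; y] \in M.
Proof.
move=> pmM; have [E ME Ex] := matching_cover x pmM.
have [/subsetP sMe _] := andP pmM; have /imsetP[[u v]] := sMe _ ME.
rewrite inE /= => euv defE; rewrite {E}defE in ME Ex.
case/set2P: Ex => ->; [exists v | exists u]; rewrite ?euv ?orbT //.
by rewrite setUC.
Qed.

Lemma matching_mate_inj M x y z : perfect_matching e M ->
  [set x; y] \in M -> [set x; z] \in M -> y = z.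
Proof.
move=> pmM Mxy Mxz; have xy := matching_edge pmM Mxy.
have Exy: [set x; y] = [set x; z] by apply: (matching_inj (x := x) pmM); rewrite ?set21.
have: y \in [set x; z] by rewrite -Exy set22.
by case/set2P=> // eq_yx; rewrite eq_yx e_irr in xy.
Qed.

Lemma mem_cycle_edges c x y : x \notin c -> ([set x; y] \in cycle_edges c) = false.
Proof.
move=> c'x; apply/imsetP=> -[z cz /setP/(_ x)]; rewrite !inE eqxx /=.
by case/esym/orP=> /eqP def_x; rewrite def_x ?mem_next cz in c'x.
Qed.

Lemma next_cycle_edges c x : x \in c -> [set x; next c x] \in cycle_edges c.
Proof. exact: imset_f. Qed.

Lemma cycle_edges_at c x E : uniq c -> x \in c -> E \in cycle_edges c ->
  x \in E -> E = [set x; next c x] \/ E = [set prev c x; x].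
Proof.
move=> Uc cx /imsetP[z cz ->] /set2P[->|def_x]; [by left | right].
by rewrite def_x prev_next.
Qed.

(** At a vertex of the cycle exactly one of the two incident cycle edges is a dimer, and the switch
    exchanges them; at other vertices nothing changes. *)
Lemma perfect_matching_switch M c :
  perfect_matching e M -> alternating_cycle e M c ->
  perfect_matching e (switch M c).
Proof.
move=> pmM /and4P[c_gt2 _ /andP[cyc_c Uc] /allP alt_c].
have [sMe _] := andP pmM.
have edge_next x := @next_cycle_edges c x.
have edge_prev x: x \in c -> [set prev c x; x] \in cycle_edges c.
  by move=> cx; rewrite -{2}(next_prev Uc x) edge_next ?mem_prev.
(* Alternation, recentred at the vertex shared by the two consecutive edges. *)
have alt x: x \in c -> ([set x; next c x] \in M) = ([set prev c x; x] \notin M).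
  move=> cx; have := alt_c (prev c x); rewrite mem_prev next_prev // => /(_ cx).
  by do 2!case: (_ \in M).
apply: perfect_matchingI => [|x|x E F].
- rewrite subUset (subset_trans _ sMe) ?subsetDl //=.
  apply: (subset_trans (subsetDl _ _)); apply/subsetP=> _ /imsetP[x cx ->].
  by apply/imsetP; exists (x, next c x); rewrite // inE next_cycle.
- have [E ME Ex] := matching_cover x pmM.
  have [cE|c'E] := boolP (E \in cycle_edges c); last first.
    by exists E; rewrite // in_switch ME (negPf c'E).
  have cx: x \in c.
    case/imsetP: cE Ex => y cy -> /set2P[]-> //; by rewrite mem_next.
  have [En|Ep] := cycle_edges_at Uc cx cE Ex.
    exists [set prev c x; x]; last exact: set22.
    by rewrite in_switch edge_prev // -[_ \in M]negbK -alt // -En ME.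
  exists [set x; next c x]; last exact: set21.
  by rewrite in_switch edge_next // alt // -Ep ME.
have [cx|c'x] := boolP (x \in c); last first.
  have notc (G : {set V}) : x \in G -> (G \in cycle_edges c) = false.
    move=> Gx; apply: contraNF c'x => /imsetP[y cy defG].
    by move: Gx; rewrite defG => /set2P[]->; rewrite ?mem_next.
  rewrite !in_switch => + + Ex Fx; rewrite !notc // !addbF => ME MF.
  exact: matching_inj pmM ME MF Ex Fx.
(* The old dimer [G] at [x] lies on the cycle and is removed, so a new dimer at [x] must be a cycle
   edge outside [M]; of the two cycle edges at [x] only one qualifies. *)
have [G /andP[Gx cG] MG]:
    exists2 G : {set V}, (x \in G) && (G \in cycle_edges c) & G \in M.
  have := alt x cx; case: (boolP ([set prev c x; x] \in M)) => Mp Mn.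
    by exists [set prev c x; x]; rewrite // set22 edge_prev.
  by exists [set x; next c x]; rewrite ?Mn // set21 edge_next.
have sw_out (H : {set V}) : H \in switch M c -> x \in H ->
    (H \in cycle_edges c) && (H \notin M).
  rewrite in_switch => sH Hx; have [MH|M'H] := boolP (H \in M).
    by rewrite (matching_inj pmM MH MG Hx Gx) MG cG in sH.
  by rewrite (negPf M'H) /= in sH; rewrite sH.
move=> /sw_out outE /sw_out outF Ex Fx.
have [/andP[cE M'E] /andP[cF M'F]] := (outE Ex, outF Fx).
move: (alt x cx) M'E M'F.
by have [->|->] := cycle_edges_at Uc cx cE Ex;
  have [->|->] := cycle_edges_at Uc cx cF Fx => // ->;
  case: (_ \in M).
Qed.

End Switching.

(** * Dimers of a rectangle in natural-number coordinates *)

Section Moves.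
Variables (V : finType) (e : rel V).
Hypotheses (e_irr : irreflexive e).

Definition tri (p q : nat * nat) : bool :=
  [|| (p.2 == q.2) && ((p.1.+1 == q.1) || (q.1.+1 == p.1)),
      (p.1 == q.1) && ((p.2.+1 == q.2) || (q.2.+1 == p.2)),
      (p.1.+1 == q.1) && (q.2.+1 == p.2) |
      (q.1.+1 == p.1) && (p.2.+1 == q.2)].

(** The rectangle is accessed only through the parametrization [pt], so that one argument serves
    both the given rectangle and its transpose. *)
Variables (w h : nat) (pt : nat * nat -> V).

Definition in_rect (p : nat * nat) : bool := (0 < p.1 <= w) && (p.2 < h).

Hypothesis pt_inj : {in in_rect &, injective pt}.
Hypothesis pt_surj : forall v, exists2 p, in_rect p & v = pt p.
Hypothesis pt_adj : {in in_rect &, forall p q, e (pt p) (pt q) = tri p q}.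
Hypothesis w_even : ~~ odd w.

Notation config := (dimer_config e).
Notation within_dimers := (within (@dimer_adj _ e 3)).
Implicit Types (M N : config) (p q r s : nat * nat) (x y : nat).

Definition dimer M p q : bool :=
  [&& in_rect p, in_rect q & [set pt p; pt q] \in val M].

Lemma config_matching M : perfect_matching e (val M).
Proof. exact: valP M. Qed.

Lemma dimer_sym M p q : dimer M p q -> dimer M q p.
Proof. by rewrite /dimer setUC => /and3P[-> -> ->]. Qed.

Lemma tri_sym : symmetric tri.
Proof. by move=> p q; rewrite /tri; lia. Qed.

Lemma dimer_rect M p q : dimer M p q -> in_rect p /\ in_rect q.
Proof. by case/and3P. Qed.

Lemma dimer_tri M p q : dimer M p q -> tri p q.
Proof.
case/and3P=> Rp Rq /(matching_edge e_irr (config_matching M)).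
by rewrite !pt_adj // (tri_sym q) orbb.
Qed.

Lemma dimer_ex M p : in_rect p -> exists q, dimer M p q.
Proof.
move=> Rp; have [v _ Mpv] := matching_mate_ex (pt p) (config_matching M).
have [q Rq def_v] := pt_surj v; exists q.
by rewrite /dimer Rp Rq -def_v.
Qed.

Lemma dimer_inj M p q r : dimer M p q -> dimer M p r -> q = r.
Proof.
case/and3P=> _ Rq Mpq /and3P[_ Rr Mpr]; apply: pt_inj => //.
exact (matching_mate_inj e_irr (config_matching M) Mpq Mpr).
Qed.

Lemma not_dimer M p q r : dimer M p q -> in_rect r -> q != r ->
  ([set pt p; pt r] \in val M) = false.
Proof.
move=> Dpq Rr; apply: contraNF => Mpr.
have Dpr: dimer M p r by rewrite /dimer Mpr Rr; case/and3P: Dpq => ->.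
exact/eqP/(dimer_inj Dpq Dpr).
Qed.

(** Uniqueness of mates as boolean equations, a form that computation and [lia] can exploit. *)
Lemma dimer_eq M p q r s : dimer M p q -> dimer M r s ->
  ((p == r) = (q == s)) /\ ((p == s) = (q == r)).
Proof.
move=> Dpq Drs; have [Dqp Dsr] := (dimer_sym Dpq, dimer_sym Drs).
split; apply/eqP/eqP=> [eq_|eq_]; rewrite eq_ in Dpq Dqp.
- exact: dimer_inj Dpq Drs.
- exact: dimer_inj Dqp Dsr.
- exact: dimer_inj Dpq Dsr.
exact: dimer_inj Dqp Drs.
Qed.

Lemma switch_config M c : size c <= 6 -> alternating_cycle e (val M) c ->
  exists2 N, dimer_adj 3 M N &
    forall A, (A \in val N) = (A \in val M) (+) (A \in cycle_edges c).
Proof.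
move=> sz_c alt_c; have pmN := perfect_matching_switch (config_matching M) alt_c.
exists (Sub (switch (val M) c) pmN : config); last by move=> A; apply: in_switch.
apply/existsP; exists (Ordinal (sz_c : size c < (2 * 3).+1)).
by apply/existsP; exists (in_tuple c); rewrite alt_c eqxx.
Qed.

(* Columns are numbered from 1 and rows from 0. The target dimers are in place in
   the rows below [y] and in the first [x] columns of row [y]; the [fresh] sites
   are the remaining ones. *)
Definition good x y M : Prop := forall i j,
  (2 * i).+1 < w -> j < h -> (j < y) || ((j == y) && (2 * i < x)) ->
  dimer M ((2 * i).+1, j) ((2 * i).+2, j).

Definition fresh x y p : bool := (y < p.2) || ((y == p.2) && (x < p.1)).

Lemma good_stable x y M N c : all (fresh x y) c ->
    (forall p q, p \notin c -> dimer M p q -> dimer N p q) ->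
  good x y M -> good x y N.
Proof.
move=> /allP frc keep gM i j lt_i lt_j proc; apply: keep; last exact: gM.
by apply/negP=> /frc; move: proc; rewrite /fresh /=; lia.
Qed.

Lemma goodS x y M : ~~ odd x -> good x y M -> dimer M (x.+1, y) (x.+2, y) ->
  good x.+2 y M.
Proof.
move=> ev_x gM Dxy i j lt_i lt_j proc.
have [/andP[/eqP-> /eqP->] //|not_new] := boolP ((2 * i == x) && (j == y)).
by apply: gM => //; lia.
Qed.

(** A processed site is already matched inside its target pair, and since [x] is even no pair
    straddles the frontier. *)
Lemma dimer_fresh x y M p q : ~~ odd x -> x <= w -> good x y M -> dimer M p q ->
  fresh x y p -> fresh x y q.
Proof.
case: p q => [i j] [i' j'] ev_x le_x gM Dpq fr_p.
have [/andP[/= Ri lt_j] /andP[/= Ri' lt_j']] := dimer_rect Dpq.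
apply/negPn/negP=> fr'q.
(* The left column of the target pair containing column [i'] is the largest odd number not exceeding
   [i']. *)
have Dq: dimer M ((2 * i'.-1./2).+1, j') ((2 * i'.-1./2).+2, j').
  by apply: gM; move: fr'q; rewrite /fresh /=; lia.
have := dimer_eq Dpq Dq; rewrite !xpair_eqE.
by move: fr_p fr'q; rewrite /fresh /=; lia.
Qed.

(** * Moves along cycles of length four and six *)

Ltac next_compute :=
  repeat match goal with
  | H : is_true (?u != ?v) |- context [?v == ?u] => rewrite (eq_sym v u) (negPf H)
  end.

Lemma uniq_map_pt c : all in_rect c -> uniq c -> uniq (map pt c).
Proof. by move=> /allP Rc; rewrite map_inj_in_uniq // => p q /Rc Rp /Rc Rq; apply: pt_inj. Qed.

Lemma dimer_off_cycle M N c p q : all in_rect c ->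
    (forall A, (A \in val N) = (A \in val M) (+) (A \in cycle_edges (map pt c))) ->
  p \notin c -> dimer M p q -> dimer N p q.
Proof.
move=> /allP Rc defN c'p /and3P[Rp Rq Mpq]; rewrite /dimer Rp Rq /= defN Mpq.
rewrite mem_cycle_edges //; apply: contra c'p => /mapP[r cr eq_pr].
by have ->: p = r by apply: pt_inj => //; apply: Rc.
Qed.

(** The edges [b c] and [d a] are not dimers yet because [b] and [d] have other mates, so the cycle
    alternates. It avoids the processed sites, hence finished dimers survive. *)
Lemma move4 x y M a b c d : good x y M -> dimer M a b -> dimer M c d ->
    [&& tri b c, tri d a, uniq [:: a; b; c; d] & all (fresh x y) [:: a; b; c; d]] ->
  exists N, [/\ dimer_adj 3 M N, good x y N, dimer N b c, dimer N d a &
    forall p q, p \notin [:: a; b; c; d] -> dimer M p q -> dimer N p q].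
Proof.
move=> gM Dab Dcd /and4P[Tbc Tda Uc fr_c].
have Tab := dimer_tri Dab; have Tcd := dimer_tri Dcd.
have [/and3P[Ra Rb Mab] /and3P[Rc Rd Mcd]] := (Dab, Dcd).
have R: all in_rect [:: a; b; c; d] by rewrite /= Ra Rb Rc Rd.
have Um := uniq_map_pt R Uc.
move: (Uc); rewrite /= !inE !negb_or andbT -!andbA.
case/and5P=> nab nac nad nbc /andP[nbd ncd].
have Mbc := not_dimer (dimer_sym Dab) Rc nac.
have Mda : ([set pt d; pt a] \in val M) = false.
  by rewrite (not_dimer (dimer_sym Dcd) Ra) // eq_sym.
have nxt: [/\ next (map pt [:: a; b; c; d]) (pt a) = pt b,
   next (map pt [:: a; b; c; d]) (pt b) = pt c,
   next (map pt [:: a; b; c; d]) (pt c) = pt d &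
   next (map pt [:: a; b; c; d]) (pt d) = pt a].
  move: Um; rewrite /= !inE !negb_or andbT -!andbA.
  case/and5P=> ? ? ? ? /andP[? ?]; rewrite !eqxx; next_compute.
  by split.
case: nxt => na nb nc nd.
have alt: alternating_cycle e (val M) (map pt [:: a; b; c; d]).
  apply/and4P; split=> //.
    rewrite /ucycleb Um /= !pt_adj // Tab Tbc Tcd Tda //.
  by rewrite /all /map -/(map pt [:: a; b; c; d]) !(na, nb, nc, nd) Mab Mcd Mbc Mda.
have [//|N MN defN] := switch_config _ alt.
have keep p q : p \notin [:: a; b; c; d] -> dimer M p q -> dimer N p q.
  exact: dimer_off_cycle.
exists N; split=> //; first exact (good_stable fr_c keep gM).
  rewrite /dimer Rb Rc defN Mbc -nb; apply: next_cycle_edges.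
  by rewrite !inE eqxx ?orbT.
rewrite /dimer Rd Ra defN Mda -nd; apply: next_cycle_edges.
by rewrite !inE eqxx ?orbT.
Qed.

Lemma move6 x y M a b c d f g :
    good x y M -> dimer M a b -> dimer M c d -> dimer M f g ->
    [&& tri b c, tri d f, tri g a, uniq [:: a; b; c; d; f; g]
      & all (fresh x y) [:: a; b; c; d; f; g]] ->
  exists N, [/\ dimer_adj 3 M N, good x y N,
    [/\ dimer N b c, dimer N d f & dimer N g a] &
    forall p q, p \notin [:: a; b; c; d; f; g] -> dimer M p q -> dimer N p q].
Proof.
move=> gM Dab Dcd Dfg /and5P[Tbc Tdf Tga Uc fr_c].
have [Tab Tcd Tfg] := And3 (dimer_tri Dab) (dimer_tri Dcd) (dimer_tri Dfg).
have [/and3P[Ra Rb Mab] /and3P[Rc Rd Mcd] /and3P[Rf Rg Mfg]] := And3 Dab Dcd Dfg.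
have R: all in_rect [:: a; b; c; d; f; g] by rewrite /= Ra Rb Rc Rd Rf Rg.
have Um := uniq_map_pt R Uc.
have [nac ncf nfa]: [/\ a != c, c != f & f != a].
  by rewrite (eq_sym f); move: (Uc); rewrite /= !inE !negb_or -!andbA;
    do ![case/andP=> ?]; split.
have Mbc := not_dimer (dimer_sym Dab) Rc nac.
have Mdf := not_dimer (dimer_sym Dcd) Rf ncf.
have Mga := not_dimer (dimer_sym Dfg) Ra nfa.
set C := map pt [:: a; b; c; d; f; g].
have [na nb nc]: [/\ next C (pt a) = pt b, next C (pt b) = pt c & next C (pt c) = pt d].
  move: Um; rewrite /= !inE !negb_or -!andbA; do ![case/andP=> ?].
  by rewrite !eqxx; next_compute.
have [nd nf ng]: [/\ next C (pt d) = pt f, next C (pt f) = pt g & next C (pt g) = pt a].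
  move: Um; rewrite /= !inE !negb_or -!andbA; do ![case/andP=> ?].
  by rewrite !eqxx; next_compute.
have alt: alternating_cycle e (val M) C.
  apply/and4P; split=> //.
    by rewrite /ucycleb Um /= !pt_adj // Tab Tbc Tcd Tdf Tfg Tga.
  have allE (P : pred V) : all P C =
      [&& P (pt a), P (pt b), P (pt c), P (pt d), P (pt f), P (pt g) & true] by [].
  by rewrite allE; cbv beta; rewrite !(na, nb, nc, nd, nf, ng) Mab Mcd Mfg Mbc Mdf Mga.
have [//|N MN defN] := switch_config _ alt.
have keep p q : p \notin [:: a; b; c; d; f; g] -> dimer M p q -> dimer N p q.
  exact: dimer_off_cycle.
exists N; split=> //; first exact (good_stable fr_c keep gM).
have newD p q : pt p \in C -> next C (pt p) = pt q -> in_rect p -> in_rect q ->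
    ([set pt p; pt q] \in val M) = false -> dimer N p q.
  by move=> Cp def_q Rp Rq Mpq; rewrite /dimer Rp Rq defN Mpq -def_q next_cycle_edges.
by split; apply: newD => //; rewrite !inE eqxx ?orbT.
Qed.

(** * Offsets from the frontier and the possible mates of a site *)

Section NextDimer.
Variables x y : nat.
Hypotheses (x_even : ~~ odd x) (lt_xw : x < w) (lt_yh : y < h).

(* The first unprocessed site has offset [(1, 0)], so that its neighbour in the
   column before it still has nonnegative offset. In hypothesis names, v u d k are
   the offsets (1, 0) to (4, 0), a b c s are (0, 1) to (3, 1), and f is (2, 2). *)
Definition site (p : nat * nat) : nat * nat := (x + p.1, y + p.2).

Notation pair M p q := (dimer M (site p) (site q)).

Lemma site_inj : injective site.
Proof. by move=> [i j] [i' j'] [/addnI-> /addnI->]. Qed.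

Lemma site_tri p q : tri (site p) (site q) = tri p q.
Proof. by rewrite /tri /= -!addnS !eqn_add2l. Qed.

Lemma site_fresh p : fresh x y (site p) = fresh 0 0 p.
Proof.
rewrite /fresh /= -[X in X < y + _]addn0 -[X in X == _]addn0.
by rewrite -[X in X < x + _]addn0 !ltn_add2l eqn_add2l.
Qed.

Lemma all_fresh_site c : all (fresh x y) (map site c) = all (fresh 0 0) c.
Proof. by rewrite all_map; apply: eq_all => p /=; apply: site_fresh. Qed.

(** The rectangle is a product of intervals; known sites thus guarantee the existence of the further
    sites met in the case analysis. *)
Lemma rect_cross p q : 0 < p.1 -> in_rect (site p) -> in_rect (site q) ->
  in_rect (site (p.1, q.2)).
Proof.
move=> p_gt0 /andP[/andP[_ le_p] _] /andP[_ lt_q].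
by rewrite /in_rect /= le_p lt_q addn_gt0 p_gt0 orbT.
Qed.

Lemma rect10 : in_rect (site (1, 0)).
Proof. by rewrite /in_rect /= addn0 addn1 lt_xw. Qed.

(** Both [x] and [w] are even, so [x < w] leaves room for two columns. *)
Lemma rect20 : in_rect (site (2, 0)).
Proof. by rewrite /in_rect /= addn0 lt_yh andbT; lia. Qed.

Lemma rect_lt M p : pair M p (3, 0) -> x.+2 < w.
Proof. by case/and3P=> _ /andP[/andP[_]]; rewrite /= addn3. Qed.

Lemma good_two M : good x y M -> pair M (1, 0) (2, 0) -> good x.+2 y M.
Proof. by move=> gM; rewrite /site /= addn0 addn1 addn2; apply: goodS. Qed.

Lemma good_four M : good x y M -> pair M (1, 0) (2, 0) -> pair M (3, 0) (4, 0) ->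
  good x.+4 y M.
Proof.
move=> gM D12 D34; apply: goodS; rewrite /= ?negbK //; first exact: good_two.
by move: D34; rewrite /site /= addn0 !addnS addn0.
Qed.

Lemma switch4 M a b c d : good x y M -> pair M a b -> pair M c d ->
    [&& tri b c, tri d a, uniq [:: a; b; c; d] & all (fresh 0 0) [:: a; b; c; d]] ->
  exists N, [/\ dimer_adj 3 M N, good x y N, pair N b c, pair N d a &
    forall p q, p \notin [:: a; b; c; d] -> pair M p q -> pair N p q].
Proof.
move=> gM Dab Dcd /and4P[Tbc Tda Uc fr_c].
have [|N [MN gN Nbc Nda keep]] := move4 gM Dab Dcd.
  rewrite !site_tri; apply/and4P; split=> //.
    by move: Uc; rewrite -(map_inj_uniq site_inj).
  by move: fr_c; rewrite -all_fresh_site.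
exists N; split=> // p q c'p; apply: keep.
by move: c'p; rewrite -(mem_map site_inj).
Qed.

Lemma switch6 M a b c d f g :
    good x y M -> pair M a b -> pair M c d -> pair M f g ->
    [&& tri b c, tri d f, tri g a, uniq [:: a; b; c; d; f; g]
      & all (fresh 0 0) [:: a; b; c; d; f; g]] ->
  exists N, [/\ dimer_adj 3 M N, good x y N,
    [/\ pair N b c, pair N d f & pair N g a] &
    forall p q, p \notin [:: a; b; c; d; f; g] -> pair M p q -> pair N p q].
Proof.
move=> gM Dab Dcd Dfg /and5P[Tbc Tdf Tga Uc fr_c].
have [|N [MN gN new keep]] := move6 gM Dab Dcd Dfg.
  rewrite !site_tri; apply/and5P; split=> //.
    by move: Uc; rewrite -(map_inj_uniq site_inj).
  by move: fr_c; rewrite -all_fresh_site.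
exists N; split=> // p q c'p; apply: keep.
by move: c'p; rewrite -(mem_map site_inj).
Qed.

(** Truncated predecessors may produce repetitions or [p] itself on the border; only membership
    matters, and [free_neighbours] filters by [tri]. *)
Definition neighbours (p : nat * nat) : seq (nat * nat) :=
  [:: (p.1.+1, p.2); (p.1, p.2.+1); (p.1.+1, p.2.-1);
      (p.1.-1, p.2.+1); (p.1.-1, p.2); (p.1, p.2.-1)].

Lemma tri_neighbours p q : tri p q -> q \in neighbours p.
Proof.
case: p q => [i j] [i' j'].
by case/or4P=> [/andP[]|/andP[]|/andP[]|/andP[]] /= /eqP<- => [/orP[]|/orP[]||] /eqP<-;
  rewrite !inE /= eqxx ?orbT.
Qed.

Lemma tri_le p q : tri p q -> p.1 <= q.1.+1.
Proof.
by case/or4P=> [/andP[_]|/andP[]|/andP[]|/andP[]] => [/orP[]|||] /eqP<- // *;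
  rewrite ltnW // ltnW.
Qed.

Lemma site_neighbours p r : 0 < p.1 -> y <= r.2 -> tri (site p) r ->
  exists2 q, q \in neighbours p & r = site q.
Proof.
move=> p_gt0 le_y Tpr; have le_x: x <= r.1.
  by rewrite -ltnS; apply: leq_trans (tri_le Tpr); rewrite /= -addn1 leq_add2l.
have def_r: r = site (r.1 - x, r.2 - y).
  by case: r {Tpr} le_x le_y => ? ? /= *; rewrite /site /= !subnKC.
exists (r.1 - x, r.2 - y) => //; apply: tri_neighbours.
by rewrite -site_tri -def_r.
Qed.

Definition free_neighbours p (used : seq ((nat * nat) * (nat * nat))) :=
  [seq q <- neighbours p | tri p q && fresh 0 0 q &&
     all (fun d => (q != d.1) && (q != d.2)) used].

(** The mate of a fresh site is a fresh neighbour not covered by the dimers in [used]. This reduces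
    each choice of a mate to a computed list of offsets. *)
Lemma mate_cases M p used : good x y M -> in_rect (site p) ->
    all (fun d => pair M d.1 d.2) used ->
    [&& 0 < p.1, fresh 0 0 p & all (fun d => (d.1 != p) && (d.2 != p)) used] ->
  exists2 q, q \in free_neighbours p used & pair M p q.
Proof.
move=> gM Rp /allP usedM /and3P[p_gt0 Fp /allP usedp].
have [r Dpr] := dimer_ex M Rp; have Tpr := dimer_tri Dpr.
have Fr: fresh x y r.
  by rewrite (dimer_fresh x_even (ltnW lt_xw) gM Dpr) // site_fresh.
have le_yr: y <= r.2 by case/orP: Fr => [/ltnW//|/andP[/eqP-> _]].
have [q Nq def_r] := site_neighbours p_gt0 le_yr Tpr; rewrite {r}def_r in Dpr Tpr Fr le_yr.
exists q; rewrite // mem_filter Nq andbT -site_tri -site_fresh Tpr Fr.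
apply/allP=> d used_d; have /andP[np1 np2] := usedp d used_d.
have [eq1 eq2] := dimer_eq Dpr (usedM d used_d).
rewrite !(inj_eq site_inj) in eq1 eq2; rewrite -eq1 -eq2.
by rewrite (eq_sym p) (eq_sym p d.1) np1 np2.
Qed.


(* All geometric side conditions are closed boolean computations on offsets. *)
Ltac mate gM p used cands Rp q D :=
  let Q := fresh "Q" in
  have [||q Q D] := mate_cases (p := p) (used := used) gM Rp;
  [ cbn [all fst snd]; repeat (apply/andP; split; [assumption |]); exact: isT | by []
  | have {}Q : q \in cands := allP (isT : all (mem cands) (free_neighbours p used)) _ Q;
    move: Q; rewrite !inE ].

(** * Case analysis near the first unprocessed site *)

Lemma within1 M N : dimer_adj 3 M N -> good x y N -> pair N (2, 0) (1, 0) ->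
  within_dimers 1 (good x.+2 y) M.
Proof.
move=> MN gN /dimer_sym D12; apply: (withinS MN); apply: within0.
exact: good_two.
Qed.

(** Switching the 4-cycle [v b c u] suffices. It leaves the pair [d k] alone, so if that is already
    a dimer, two target dimers are gained at once. *)
Lemma square_step M : good x y M ->
    pair M (1, 0) (1, 1) -> pair M (2, 0) (2, 1) ->
  within_dimers 1 (good x.+2 y) M /\
  (pair M (3, 0) (4, 0) -> within_dimers 1 (good x.+4 y) M).
Proof.
move=> gM Dvb /dimer_sym Dcu.
have [//|N [MN gN _ Nuv keep]] := switch4 gM Dvb Dcu.
split=> [|Ddk]; first exact: within1 gN Nuv.
apply: (withinS MN); apply: within0; apply: good_four => //; first exact: dimer_sym.
exact: keep.
Qed.

(** The only free neighbours of [b] are (1, 2) and (0, 2). In either case the dimer at [b],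
    traversed in a suitable direction, links [a] to [c] and closes a 6-cycle through [u v]. *)
Lemma hexagon_step M : good x y M ->
    pair M (1, 0) (0, 1) -> pair M (2, 0) (2, 1) ->
  within_dimers 1 (good x.+2 y) M.
Proof.
move=> gM Dva Duc; have Dcu := dimer_sym Duc.
have Rb := rect_cross (p := (1, 0)) isT rect10 (dimer_rect Dva).2.
mate gM (1, 1) [:: ((1, 0), (0, 1)); ((2, 0), (2, 1))] [:: (1, 2); (0, 2)] Rb q Dbq.
case/orP=> /eqP def_q; rewrite {q}def_q in Dbq.
  have [//|N [MN gN [_ _ Nuv] _]] := switch6 gM Dva Dbq Dcu.
  exact: within1 gN Nuv.
have [//|N [MN gN [_ _ Nuv] _]] := switch6 gM Dva (dimer_sym Dbq) Dcu.
exact: within1 gN Nuv.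
Qed.

(** The 6-cycle [u d k s f c] creates [d k] and stands [u c] next to [v b]; [square_step] then
    finishes both target dimers. *)
Lemma two_dimers_step M : good x y M ->
    pair M (1, 0) (1, 1) -> pair M (2, 0) (3, 0) ->
    pair M (2, 1) (2, 2) -> pair M (3, 1) (4, 0) ->
  within_dimers 2 (good x.+4 y) M.
Proof.
move=> gM Dvb Dud Dcf Dsk.
have [//|N [MN gN [Ndk _ Ncu] keep]] := switch6 gM Dud (dimer_sym Dsk) (dimer_sym Dcf).
apply: (withinS MN); have [_] := square_step gN (keep (1, 0) (1, 1) isT Dvb) (dimer_sym Ncu).
exact.
Qed.

Lemma two_dimers_step3 M q : good x y M ->
    pair M (1, 0) (1, 1) -> pair M (2, 0) (3, 0) ->
    pair M (2, 1) (2, 2) -> pair M (3, 1) q -> q = (4, 1) \/ q = (4, 0) ->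
  within_dimers 3 (good x.+4 y) M.
Proof.
move=> gM Dvb Dud Dcf Dsq [] def_q; rewrite {q}def_q in Dsq; last first.
  by apply: (@within_le _ _ 2); last exact: two_dimers_step.
have Rk := rect_cross (p := (4, 1)) isT (dimer_rect Dsq).2 rect10.
(* With (3, 0) and both next-row neighbours of [k] taken, its mate is forced; one 4-cycle then pairs
   [s] with [k]. *)
mate gM (4, 0) [:: ((2, 0), (3, 0)); ((3, 1), (4, 1))] [:: (5, 0)] Rk q Dkq.
move/eqP=> def_q; rewrite {q}def_q in Dkq.
have [//|N [MN gN _ Nks keep]] := switch4 gM Dsq (dimer_sym Dkq).
apply: (withinS MN); apply: two_dimers_step => //; try exact: keep.
exact: dimer_sym.
Qed.

(** The mates of [u], [c] and [s] are determined in this order until a short alternating cycle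
    appears. The branches that are too costly for one target dimer yield two of them. *)
Lemma up_step M : good x y M -> pair M (1, 0) (1, 1) ->
  within_dimers 2 (good x.+2 y) M \/
  x.+2 < w /\ within_dimers 3 (good x.+4 y) M.
Proof.
move=> gM Dvb; have Rb := (dimer_rect Dvb).2.
mate gM (2, 0) [:: ((1, 0), (1, 1))] [:: (3, 0); (2, 1)] rect20 q Duq.
case/orP=> /eqP def_q; rewrite {q}def_q in Duq; last first.
  by left; apply: within_le (square_step gM Dvb Duq).1.
have lt_x2 := rect_lt Duq; have Ddu := dimer_sym Duq.
have Rc := rect_cross (p := (2, 0)) isT rect20 Rb.
mate gM (2, 1) [:: ((1, 0), (1, 1)); ((2, 0), (3, 0))] [:: (3, 1); (2, 2); (1, 2)] Rc q Dcq.
case/or3P=> /eqP def_q; rewrite {q}def_q in Dcq; have Dqc := dimer_sym Dcq.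
- have [//|N [MN gN [_ _ Nuv] _]] := switch6 gM Dvb Dcq Ddu.
  by left; apply: within_le (within1 MN gN Nuv).
- have Rs := rect_cross (p := (3, 0)) isT (dimer_rect Duq).2 Rb.
  mate gM (3, 1) [:: ((2, 0), (3, 0)); ((2, 1), (2, 2))] [:: (4, 1); (3, 2); (4, 0)] Rs q Dsq.
  case/or3P=> /eqP def_q.
  + by right; split=> //; apply: two_dimers_step3 Dsq _ => //; left.
  (* The 6-cycle through (3, 2) and [f] pairs [c] with [u], which leaves a 4-cycle to switch. *)
  + rewrite {q}def_q in Dsq; left.
    have [//|N [MN gN [_ _ Ncu] keep]] := switch6 gM Duq Dsq Dqc.
    apply: (withinS MN); apply: (square_step gN _ (dimer_sym Ncu)).1.
    exact: keep.
  by right; split=> //; apply: two_dimers_step3 Dsq _ => //; right.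
have [//|N [MN gN [_ _ Nuv] _]] := switch6 gM Dvb Dqc Ddu.
by left; apply: within_le (within1 MN gN Nuv).
Qed.

Lemma flat_step M : good x y M -> pair M (1, 0) (0, 1) ->
    pair M (2, 0) (3, 0) -> pair M (1, 1) (2, 1) ->
  within_dimers 1 (good x.+2 y) M.
Proof.
move=> gM Dva Dud Dbc.
have [//|N [MN gN [_ _ Nuv] _]] := switch6 gM Dva Dbc (dimer_sym Dud).
exact: within1 gN Nuv.
Qed.

(** The parallel dimers [u d] and [c s] are turned into [u c] and [d s], after which [hexagon_step]
    applies. *)
Lemma slide_step M : good x y M -> pair M (1, 0) (0, 1) ->
    pair M (2, 0) (3, 0) -> pair M (2, 1) (3, 1) ->
  within_dimers 2 (good x.+2 y) M.
Proof.
move=> gM Dva Dud Dcs.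
have [//|N [MN gN _ Ncu keep]] := switch4 gM Dud (dimer_sym Dcs).
apply: (withinS MN); apply: hexagon_step gN _ (dimer_sym Ncu).
exact: keep.
Qed.

(** One 4-cycle through [a], [v], [b] and (0, 2) pairs [v] with [b], as in [up_step]. Where this
    detour would cost three moves for a single dimer, the switch is made on [M] itself; where two
    dimers result, one extra move is affordable. *)
Lemma lifted_step M : good x y M -> pair M (1, 0) (0, 1) ->
    pair M (2, 0) (3, 0) -> pair M (1, 1) (0, 2) ->
  within_dimers 2 (good x.+2 y) M \/
  x.+2 < w /\ within_dimers 4 (good x.+4 y) M.
Proof.
move=> gM Dva Duq Dbq; have lt_x2 := rect_lt Duq; have Dav := dimer_sym Dva.
have Rb := (dimer_rect Dbq).1.
have [//|N [MN gN Nvb _ keep]] := switch4 gM Dav Dbq.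
have Rc := rect_cross (p := (2, 0)) isT rect20 Rb.
mate gM (2, 1) [:: ((1, 0), (0, 1)); ((2, 0), (3, 0)); ((1, 1), (0, 2))]
  [:: (3, 1); (2, 2); (1, 2)] Rc q Dcq.
case/or3P=> /eqP def_q; rewrite {q}def_q in Dcq.
- by left; apply: slide_step.
- have Rs := rect_cross (p := (3, 0)) isT (dimer_rect Duq).2 Rb.
  mate gM (3, 1) [:: ((2, 0), (3, 0)); ((2, 1), (2, 2))] [:: (4, 1); (3, 2); (4, 0)] Rs q Dsq.
  have two: q = (4, 1) \/ q = (4, 0) -> within_dimers 4 (good x.+4 y) M.
    move=> def_q; apply: (withinS MN).
    by apply: (two_dimers_step3 (q := q)) => //; apply: keep => //; case: def_q => ->.
  case/or3P=> /eqP def_q; [by right; split=> //; apply: two; left | left |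
    by right; split=> //; apply: two; right].
  rewrite {q two}def_q in Dsq.
  (* Here [N] is bypassed: pairing [c] with [u] while [v a] stays prepares [hexagon_step]. *)
  have [//|N1 [MN1 gN1 [_ _ Ncu] keep1]] := switch6 gM Duq Dsq (dimer_sym Dcq).
  apply: (withinS MN1); apply: hexagon_step (dimer_sym Ncu) => //.
  exact: keep1.
left; apply: (withinS MN).
have Nqc := keep (1, 2) (2, 1) isT (dimer_sym Dcq).
have Ndu := keep (3, 0) (2, 0) isT (dimer_sym Duq).
have [//|N1 [MN1 gN1 [_ _ Nuv] _]] := switch6 gN Nvb Nqc Ndu.
exact: within1 gN1 Nuv.
Qed.

Lemma diagonal_step M : good x y M -> pair M (1, 0) (0, 1) ->
  within_dimers 2 (good x.+2 y) M \/
  x.+2 < w /\ within_dimers 4 (good x.+4 y) M.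
Proof.
move=> gM Dva.
mate gM (2, 0) [:: ((1, 0), (0, 1))] [:: (3, 0); (2, 1); (1, 1)] rect20 q Duq.
case/or3P=> /eqP def_q; rewrite {q}def_q in Duq; first last.
- have [//|N [MN gN _ Nuv _]] := switch4 gM Dva (dimer_sym Duq).
  by left; apply: within_le (within1 MN gN Nuv).
- by left; apply: within_le (hexagon_step gM Dva Duq).
have Rb := rect_cross (p := (1, 0)) isT rect10 (dimer_rect Dva).2.
mate gM (1, 1) [:: ((1, 0), (0, 1)); ((2, 0), (3, 0))] [:: (2, 1); (1, 2); (0, 2)] Rb q Dbq.
case/or3P=> /eqP def_q; rewrite {q}def_q in Dbq; last exact: lifted_step.
  by left; apply: within_le (flat_step gM Dva Duq Dbq).
left; have Rc := rect_cross (p := (2, 0)) isT rect20 Rb.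
mate gM (2, 1) [:: ((1, 0), (0, 1)); ((2, 0), (3, 0)); ((1, 1), (1, 2))]
  [:: (3, 1); (2, 2)] Rc q Dcq.
case/orP=> /eqP def_q; rewrite {q}def_q in Dcq; first exact: slide_step.
(* The two parallel dimers from [b] and [c] into the next row are laid flat, which creates the dimer
   [b c]. *)
have [//|N [MN gN _ Ncb keep]] := switch4 gM Dbq (dimer_sym Dcq).
apply: (withinS MN); apply: flat_step (dimer_sym Ncb) => //; exact: keep.
Qed.

(** The site [v] has only three possible mates. In both outcomes the budget is one move per newly
    processed site. *)
Lemma progress M : good x y M ->
  within_dimers 2 (good x.+2 y) M \/
  x.+2 < w /\ within_dimers 4 (good x.+4 y) M.
Proof.
move=> gM.
mate gM (1, 0) ([::] : seq ((nat * nat) * (nat * nat))) [:: (2, 0); (1, 1); (0, 1)] rect10 q Dvq.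
case/or3P=> /eqP def_q; rewrite {q}def_q in Dvq; last exact: diagonal_step.
  by left; apply: within0; apply: good_two.
have [|[lt_x2 M3]] := up_step gM Dvq; first by left.
by right; split=> //; apply: within_le M3.
Qed.

End NextDimer.

(** * Sweeping the rows, and uniqueness of the target *)

Lemma row_steps x y M : ~~ odd x -> x <= w -> y < h -> good x y M ->
  within_dimers (w - x) (good w y) M.
Proof.
have [n] := ubnP (w - x); elim: n => // n IHn in x M * => lt_n ev_x le_xw lt_yh gM.
have [lt_xw|ge_xw] := ltnP x w; last first.
  by apply: within0; have ->: w = x by lia.
have [M2|[lt_x2 M4]] := progress ev_x lt_xw lt_yh gM.
  have ->: w - x = 2 + (w - x.+2) by lia.
  by apply: within_trans M2 _ => N gN; apply: IHn => //=; lia.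
(* By parity [x.+2 < w] gives [x.+4 <= w], so the subtraction does not truncate. *)
have ->: w - x = 4 + (w - x.+4) by lia.
by apply: within_trans M4 _ => N gN; apply: IHn => //=; lia.
Qed.

Lemma good_row y M : good w y M -> good 0 y.+1 M.
Proof. by move=> gM i j lt_i lt_j proc; apply: gM => //; lia. Qed.

Lemma all_rows_steps y M : y <= h -> good 0 y M ->
  within_dimers (w * (h - y)) (good 0 h) M.
Proof.
have [n] := ubnP (h - y); elim: n => // n IHn in y M * => lt_n le_yh gM.
have [lt_yh|ge_yh] := ltnP y h; last first.
  by apply: within0; have ->: h = y by lia.
have ->: w * (h - y) = (w - 0) + w * (h - y.+1) by rewrite subn0 -mulnS; congr (_ * _); lia.
apply: within_trans (row_steps _ _ lt_yh gM) _ => // N /good_row gN.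
by apply: IHn => //; lia.
Qed.

(** Every site belongs to a target pair, so a dimer of [M] must be the target dimer at its endpoint,
    which [N] contains as well. *)
Lemma good_sub M N : good 0 h M -> good 0 h N -> val M \subset val N.
Proof.
move=> gM gN; apply/subsetP=> E ME.
have [/subsetP sMe _] := andP (config_matching M).
have /imsetP[[u v] _ /= defE] := sMe _ ME; rewrite {E}defE in ME *.
have [[p Rp def_u] [q Rq def_v]] := (pt_surj u, pt_surj v).
rewrite {}def_u {}def_v in ME *; have Dpq: dimer M p q by rewrite /dimer Rp Rq.
suff: dimer N p q by case/and3P.
case: p {Rp ME} Dpq => i j Dpq; have [/andP[/= Ri lt_j] _] := dimer_rect Dpq.
have lt_i2: (2 * i.-1./2).+1 < w by lia.
have [DM DN] := (gM _ _ lt_i2 lt_j, gN _ _ lt_i2 lt_j).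
rewrite lt_j /= in DM DN.
have [def_i|def_i]: i = (2 * i.-1./2).+1 \/ i = (2 * i.-1./2).+2 by lia.
  rewrite [X in dimer M (X, _)]def_i in Dpq; rewrite [X in dimer N (X, _)]def_i.
  by rewrite (dimer_inj Dpq (DM isT)) DN.
rewrite [X in dimer M (X, _)]def_i in Dpq; rewrite [X in dimer N (X, _)]def_i.
by rewrite (dimer_inj Dpq (dimer_sym (DM isT))) dimer_sym ?DN.
Qed.

Lemma good_unique M N : good 0 h M -> good 0 h N -> M = N.
Proof. by move=> gM gN; apply/val_inj/eqP; rewrite eqEsubset !good_sub. Qed.

(** * Existence of the target configuration *)

Definition flip (p : nat * nat) : nat * nat := (if odd p.1 then p.1.+1 else p.1.-1, p.2).

Lemma flipK p : in_rect p -> flip (flip p) = p.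
Proof.
case: p => i j /andP[/= Ri _]; rewrite /flip /=; case: (boolP (odd i)) => oi;
  congr (_, _); case: ifP; lia.
Qed.

Lemma flip_rect p : in_rect p -> in_rect (flip p).
Proof. by case: p => i j; rewrite /in_rect /flip /=; case: ifP; lia. Qed.

Lemma flip_tri p : in_rect p -> tri p (flip p).
Proof.
case: p => i j /andP[/andP[/= gt0i _] _]; rewrite /tri /flip /= eqxx /=.
by case: ifP => _; rewrite ?prednK ?eqxx ?orbT.
Qed.

Definition flip_edge (p : nat * nat) : {set V} := [set pt p; pt (flip p)].

(** Indexing by all sites lists each dimer once from either end, which is harmless in a set and
    makes covering immediate. *)
Definition flip_matching : {set {set V}} :=
  [set flip_edge ((val p.1).+1, val p.2) | p in [set: 'I_w * 'I_h]].

Lemma flip_matchingP E :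
  reflect (exists2 p, in_rect p & E = flip_edge p) (E \in flip_matching).
Proof.
apply: (iffP imsetP) => [[[i j] _ ->]|[[[|i] j] /andP[//= lt_i lt_j] ->]].
  by exists ((val i).+1, val j); rewrite // /in_rect /= !ltn_ord.
by exists (Ordinal lt_i, Ordinal lt_j); rewrite ?inE.
Qed.

Lemma flip_edge_eq p r : in_rect p -> in_rect r -> pt r \in flip_edge p ->
  flip_edge p = flip_edge r.
Proof.
move=> Rp Rr /set2P[] eq_r; first by rewrite (pt_inj Rr Rp eq_r).
by rewrite (pt_inj Rr (flip_rect Rp) eq_r) /flip_edge flipK // setUC.
Qed.

Lemma flip_perfect : perfect_matching e flip_matching.
Proof.
apply: perfect_matchingI.
- apply/subsetP=> _ /flip_matchingP[p Rp ->]; apply/imsetP; exists (pt p, pt (flip p)) => //.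
  by rewrite inE /= pt_adj ?flip_tri //; apply: flip_rect.
- move=> v; have [p Rp ->] := pt_surj v; exists (flip_edge p); last exact: set21.
  by apply/flip_matchingP; exists p.
move=> v _ _ /flip_matchingP[p Rp ->] /flip_matchingP[q Rq ->].
have [r Rr ->] := pt_surj v => pr qr.
by rewrite (flip_edge_eq Rp Rr pr) (flip_edge_eq Rq Rr qr).
Qed.

Lemma rectangle_dimers :
  connected_graph (dimer_adj (e := e) 3) /\
  diameter (dimer_adj (e := e) 3) <= w * h + w * h.
Proof.
pose C : config := Sub flip_matching flip_perfect.
have gC: good 0 h C.
  move=> i j lt_i lt_j _; rewrite /dimer /in_rect /= lt_j lt_i (ltnW lt_i) /=.
  apply/flip_matchingP; exists ((2 * i).+1, j); first by rewrite /in_rect /= lt_j (ltnW lt_i).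
  by rewrite /flip_edge /flip /= oddM.
apply: (connected_diameter_le (c := C)); first exact: dimer_adj_sym.
move=> M; have gM: good 0 0 M by move=> i j; lia.
have [p [Mp szp gN]] := all_rows_steps (leq0n h) gM.
by rewrite subn0 in szp; exists p; split=> //; apply: good_unique.
Qed.

End Moves.

(** * Application to the triangular lattice rectangle *)

Lemma tri_rect_tri m n (u v : 'I_m * 'I_n) :
  tri_rect u v = tri (val u.1, val u.2) (val v.1, val v.2).
Proof.
case: u v => [i j] [i' j']; rewrite /tri_rect /= /tri_lattice /lattice_point /=.
have -> (a b c d : int) : ((c, d) - (a, b) = (c - a, d - b))%R by [].
by rewrite !inE !xpair_eqE /tri /=; lia.
Qed.

Theorem theorem1p8 (m n : nat) (hm : 0 < m) (hn : 0 < n)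
    (hmn : ~~ odd (m * n)) :
  connected_graph (dimer_adj (e := @tri_rect m n) 3) /\
  diameter (dimer_adj (e := @tri_rect m n) 3) <= 2 * m * n.
Proof.
rewrite -mulnA mul2n -addnn; case: m n hm hn hmn => [|m] [|n] // _ _.
rewrite oddM negb_and => /orP[ev_m|ev_n].
  (* The predecessor converts columns numbered from 1 into ordinals; [inord] is the reason for
     writing both sides as successors. *)
  apply: (@rectangle_dimers _ _ (@tri_rect_irr _ _) m.+1 n.+1
    (fun p => (inord p.1.-1, inord p.2))) => //.
  - move=> [[|i] j] [[|i'] j'] // /andP[/= lt_i lt_j] /andP[/= lt_i' lt_j'] [].
    by move/(congr1 val) => /= + /(congr1 val) /=; rewrite !inordK // => -> ->.
  - move=> [i j]; exists ((val i).+1, val j); first by rewrite /in_rect /= !ltn_ord.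
    by rewrite /= !inord_val.
  move=> [[|i] j] [[|i'] j'] // /andP[/= lt_i lt_j] /andP[/= lt_i' lt_j'].
  by rewrite tri_rect_tri /= !inordK.
(* When only [n] is known to be even, the coordinates are exchanged; [tri] is invariant because its
   two diagonal directions are swapped. *)
rewrite (mulnC m.+1).
apply: (@rectangle_dimers _ _ (@tri_rect_irr _ _) n.+1 m.+1
  (fun p => (inord p.2, inord p.1.-1))) => //.
- move=> [[|i] j] [[|i'] j'] // /andP[/= lt_i lt_j] /andP[/= lt_i' lt_j'] [].
  by move/(congr1 val) => /= + /(congr1 val) /=; rewrite !inordK // => -> ->.
- move=> [i j]; exists ((val j).+1, val i); first by rewrite /in_rect /= !ltn_ord.
  by rewrite /= !inord_val.
move=> [[|i] j] [[|i'] j'] // /andP[/= lt_i lt_j] /andP[/= lt_i' lt_j'].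
by rewrite tri_rect_tri /= !inordK // /tri /=; lia.
Qed.
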